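(* Let $K$ be a field, let $n$ be a positive integer, and let $\Lambda \subseteq \Theta_n$ be an index set. Let $$\mathbf t_1 = (i_1,j_1,k_1),\ \mathbf t_2 = (i_2,j_2,k_2),\ \ldots,\ \mathbf t_m = (i_m,j_m,k_m)$$ be an enumeration of the triples in $\Lambda$, and let $Q$ be the set of quadruples for $\Lambda$. Then for elements $\alpha \in \mathcal S_\Lambda(K)$, with structure constants $\alpha_{ij}^k$, the Jacobi Identity for the product $\alpha$ is equivalent to the system of equations $$\sum_{q(\mathbf t_p,\mathbf t_r) = (i,j,k,l)} \operatorname{sign}(\mathbf t_p,\mathbf t_r)\, \alpha_{i_p j_p}^{k_p}\,\alpha_{i_r j_r}^{k_r} = 0, \qquad (i,j,k,l)\in Q,$$ where, for each $(i,j,k,l)\in Q$, the sum is over all (unordered) aligned pairs $\{\mathbf t_p,\mathbf t_r\}$ of triples in $\Lambda$ whose quadruple is $(i,j,k,l)$.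
   Context: Notation. $[n]=\{1,\dots,n\}$; $\Upsilon_n=\{(i,j,k)\in[n]^3 : i<j\}$; $\Theta_n=\{(i,j,k)\in[n]^3 : i<j<k\}\subseteq\Upsilon_n$. An index set is a subset of $\Upsilon_n$. Fix a basis $x_1,\dots,x_n$ of $K^n$. An element $\alpha\in\wedge^2(K^n)^*\otimes K^n$ is an alternating bilinear map $K^n\times K^n\to K^n$; its structure constants are defined by $\alpha(x_i,x_j)=\sum_k\alpha_{ij}^k x_k$. It defines a (nonassociative, anticommutative) algebra on $K^n$. $\mathcal S_\Lambda(K)$ is the set of all $\alpha\in\wedge^2(K^n)^*\otimes K^n$ such that, for all $(i,j,k)\in\Upsilon_n$, $\alpha_{ij}^k\neq0$ if and only if $(i,j,k)\in\Lambda$. Aligned pairs. To a triple $(i,j,k)$ associate the real root vector $\mathbf y_{(i,j,k)}=\mathbf e_i+\mathbf e_j-\mathbf e_k\in\mathbb R^n$ ($\mathbf e_i$ the standard basis). Two triples $\mathbf t_1,\mathbf t_2\in\Theta_n$ form an aligned pair $\{\mathbf t_1,\mathbf t_2\}$ if $\langle \mathbf y_{\mathbf t_1},\mathbf y_{\mathbf t_2}\rangle=-1$ (standard inner product). In this case the symmetric difference of the two underlying index sets $\{i_1,j_1,k_1\}$ and $\{i_2,j_2,k_2\}$ has four elements $q_1<q_2<q_3<q_4$, and the two index sets have exactly one common element $r$. Quadruples. The quadruple of the aligned pair is $q(\mathbf t_1,\mathbf t_2)=(q_1,q_2,q_3,q_4)\in[n]^4$; it does not depend on the order of $\mathbf t_1,\mathbf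 t_2$. The set $Q$ of quadruples for $\Lambda$ is the set of all $q(\mathbf t_1,\mathbf t_2)$ for aligned pairs $\{\mathbf t_1,\mathbf t_2\}$ with $\mathbf t_1,\mathbf t_2\in\Lambda$. Signs. $\operatorname{sign}(\mathbf t_1,\mathbf t_2)\in\{1,-1\}$ is defined by: $+1$ if $\{\mathbf t_1,\mathbf t_2\}$ is $\{(q_1,q_2,r),(r,q_3,q_4)\}$, $\{(q_1,q_3,r),(q_2,r,q_4)\}$ or $\{(q_2,q_3,r),(r,q_1,q_4)\}$; $-1$ if $\{\mathbf t_1,\mathbf t_2\}$ is $\{(q_1,q_2,r),(q_3,r,q_4)\}$, $\{(q_1,q_3,r),(r,q_2,q_4)\}$ or $\{(q_2,q_3,r),(q_1,r,q_4)\}$. (Every aligned pair in $\Theta_n$ is of exactly one of these six forms; the forms containing $(r,q_2,q_4)$ and $(r,q_1,q_4)$ do not actually occur in $\Theta_n$.) The Jacobi Identity for $\alpha$ is $\alpha(\alpha(x,y),z)+\alpha(\alpha(y,z),x)+\alpha(\alpha(z,x),y)=0$ for all $x,y,z\in K^n$. *)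

(* Defs.v *)
From HB Require Import structures.
From mathcomp Require Import all_boot all_order all_algebra.
From mathcomp Require Import reals.

Set Implicit Arguments.
Unset Strict Implicit.
Unset Printing Implicit Defensive.

Import Order.TTheory GRing.Theory Num.Theory.

Local Open Scope ring_scope.

(* The index set [n] = {1, ..., n} is represented by 'I_n = {0, ..., n - 1},
   with the same order. *)
Definition triple (n : nat) : finType := ('I_n * 'I_n * 'I_n)%type.

Definition Upsilon (n : nat) : {set triple n} :=
  [set t : triple n | let: (i, j, k) := t in (i < j)%N].

Definition Theta (n : nat) : {set triple n} :=
  [set t : triple n | let: (i, j, k) := t in (i < j < k)%N].

Section Algebras.
Variables (K : fieldType) (n : nat).
Implicit Types (x : n.-tuple 'rV[K]_n)
  (alpha : {bilinear 'rV[K]_n -> 'rV[K]_n -> 'rV[K]_n}).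

Definition alternating alpha := forall u, alpha u u = 0.

(* When x is a basis, alpha x_i x_j = \sum_k struct_const x alpha i j k *: x_k *)
Definition struct_const x alpha (i j k : 'I_n) : K :=
  coord x k (alpha (tnth x i) (tnth x j)).

Definition in_S x (Lambda : {set triple n}) alpha : Prop :=
  alternating alpha /\
  forall i j k : 'I_n, (i, j, k) \in Upsilon n ->
    (struct_const x alpha i j k != 0 <-> (i, j, k) \in Lambda).

Definition jacobi_identity alpha : Prop :=
  forall u v w : 'rV[K]_n,
    alpha (alpha u v) w + alpha (alpha v w) u + alpha (alpha w u) v = 0.

End Algebras.

Section Aligned.
Variables (R : realType) (n : nat).
Implicit Types (t : triple n) (L : {set triple n}).

Definition root_vector t : 'rV[R]_n :=
  let: (i, j, k) := t in delta_mx 0 i + delta_mx 0 j - delta_mx 0 k.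

Definition inner_product (u v : 'rV[R]_n) : R := \sum_(i < n) u 0 i * v 0 i.

Definition aligned t1 t2 : bool :=
  [&& t1 \in Theta n, t2 \in Theta n
    & inner_product (root_vector t1) (root_vector t2) == -1].

Definition index_set t : {set 'I_n} :=
  let: (i, j, k) := t in [set i; j; k].

(* The symmetric difference of the two index sets, listed in increasing order
   (enum enumerates 'I_n increasingly); for an aligned pair this is
   [:: q1; q2; q3; q4]. *)
Definition quadruple t1 t2 : seq 'I_n :=
  enum ((index_set t1 :\: index_set t2) :|: (index_set t2 :\: index_set t1)).

Definition quadruples L : {set 4.-tuple 'I_n} :=
  [set q : 4.-tuple 'I_n |
    [exists t1 in L, exists t2 in L,
      aligned t1 t2 && (quadruple t1 t2 == q :> seq 'I_n)]].

(* The value 0 is a dummy: it is only taken on pairs that are not aligned. *)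
Definition sign t1 t2 : int :=
  match quadruple t1 t2, enum (index_set t1 :&: index_set t2) with
  | [:: q1; q2; q3; q4], [:: r] =>
      let pair : {set triple n} := [set t1; t2] in
      if [|| pair == [set (q1, q2, r); (r, q3, q4)],
             pair == [set (q1, q3, r); (q2, r, q4)]
           | pair == [set (q2, q3, r); (r, q1, q4)]] then 1
      else if [|| pair == [set (q1, q2, r); (q3, r, q4)],
                  pair == [set (q1, q3, r); (r, q2, q4)]
                | pair == [set (q2, q3, r); (q1, r, q4)]] then -1
      else 0
  | _, _ => 0
  end.

End Aligned.

Definition struct_const_at (K : fieldType) (n : nat) (x : n.-tuple 'rV[K]_n)
    (alpha : {bilinear 'rV[K]_n -> 'rV[K]_n -> 'rV[K]_n}) (t : triple n) : K :=
  let: (i, j, k) := t in struct_const x alpha i j k.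

(* Main.v *)
Require Import Defs.
From HB Require Import structures.
From mathcomp Require Import all_boot all_order all_algebra.
From mathcomp Require Import reals.
From mathcomp Require Import zify ring.

(** The Jacobiator J(u, v, w) of an alternating product is trilinear and
alternating, in every characteristic, so the Jacobi Identity amounts to the
vanishing of all coordinates
<<
  J_ijk^l = \sum_r (a_ij^r a_rk^l + a_jk^r a_ri^l + a_ki^r a_rj^l),  i < j < k
>>
(jacobi_identityP).  Since a_ij^k with i < j can be nonzero only when j < k,
every product in this sum vanishes when l <= k (jacobi_coef_eq0).  When k < l,
antisymmetry turns the products that can survive into
<<
  + a_ij^r a_rk^l                                       for j < r < k,
  - a_ij^r a_kr^l + a_ik^r a_jr^l - a_jk^r a_ir^l       for k < r < l.
>>
The pairs of triples that occur here are precisely the aligned pairs with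
quadruple (i, j, k, l).  Indeed, for triples of Theta_n the inner product of the
roots is -1 exactly when the last index of one triple, the one with the
smaller last index, is one of the first two indices of the other, and nothing
else is shared; a case analysis on the position of the remaining index gives the
four shapes above, with the sign being the one that antisymmetry produces
(aligned_feeding, feeding_pairs_quadruple, sign_feeding).  Hence J_ijk^l is the
left-hand side of the equation of index (i, j, k, l) (jacobi_coef_pairs), up to
choosing, for each unordered pair, which triple comes first
(sum_oriented_pairs).  If (i, j, k, l) is not a quadruple for Lambda, that sum
is empty, so no equation is lost by restricting to Q. *)

Set Implicit Arguments.
Unset Strict Implicit.
Unset Printing Implicit Defensive.

Import Order.TTheory GRing.Theory Num.Theory.
Local Open Scope ring_scope.

(** * Aligned pairs of triples *)

Section AlignedPairs.
Variables (R : realType) (n : nat).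
Implicit Types (i j k l r : 'I_n) (u v : triple n).

Lemma in_Theta i j k : ((i, j, k) \in Theta n) = (i < j < k)%N.
Proof. by rewrite inE. Qed.

Lemma enum_ord_ltn_sorted (A : {set 'I_n}) : sorted ltn (map val (enum A)).
Proof.
rewrite sorted_map /enum_mem; apply: sorted_filter.
  by move=> i j k; apply: ltn_trans.
by rewrite -enumT -sorted_map val_enum_ord iota_ltn_sorted.
Qed.

Lemma enum_ord_sorted (A : {set 'I_n}) (s : seq 'I_n) :
  sorted ltn (map val s) -> A =i s -> enum A = s.
Proof.
move=> s_sorted As.
have lt_irr : irreflexive (relpre val ltn : rel 'I_n) by move=> i; apply: ltnn.
have lt_tr : transitive (relpre val ltn : rel 'I_n).
  by move=> i j k; apply: ltn_trans.
apply: (irr_sorted_eq lt_tr lt_irr); last by move=> i; rewrite mem_enum As.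
  by rewrite -sorted_map enum_ord_ltn_sorted.
by rewrite -sorted_map.
Qed.

(** The inner product is moved from the reals to a count of coincidences
between indices, where it is decided by linear arithmetic. *)
Lemma alignedE i j k i' j' k' :
  aligned R (i, j, k) (i', j', k') =
  [&& (i < j < k)%N, (i' < j' < k')%N &
    ((i == i') + (i == j') + (j == i') + (j == j') + (k == k') + 1 ==
     (i == k') + (j == k') + (k == i') + (k == j'))%N].
Proof.
rewrite /aligned !in_Theta; congr [&& _, _ & _].
have dot (a b : 'I_n) :
    \sum_(s < n) (s == a)%:R * (s == b)%:R = (a == b)%:R :> R.
  rewrite (bigD1 a) //= big1 => [|s /negbTE sa]; last by rewrite sa mul0r.
  by rewrite eqxx mul1r addr0.
rewrite /inner_product /root_vector; under eq_bigr => s _ do rewrite !mxE.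
transitivity (((i == i')%:R + (i == j')%:R + (j == i')%:R + (j == j')%:R
    + (k == k')%:R
  - ((i == k')%:R + (j == k')%:R + (k == i')%:R + (k == j')%:R) : R) == -1).
  congr (_ == _); rewrite -!dot -!big_split -sumrN -big_split /=.
  by apply: eq_bigr => s _; rewrite /=; ring.
rewrite -[RHS](eqr_nat R) !natrD -[LHS]subr_eq0 -[RHS]subr_eq0.
by congr (_ == _); ring.
Qed.

Lemma aligned_Theta u v : aligned R u v -> u \in Theta n /\ v \in Theta n.
Proof. by case/and3P. Qed.

Lemma alignedC u v : aligned R u v = aligned R v u.
Proof.
rewrite /aligned andbCA; congr [&& _, _ & _ == _].
by apply: eq_bigr => s _; rewrite mulrC.
Qed.

Lemma quadrupleC u v : quadruple u v = quadruple v u.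
Proof. by rewrite /quadruple setUC. Qed.

Lemma signC u v : sign u v = sign v u.
Proof. by rewrite /sign quadrupleC setIC setUC. Qed.

(** A common last index contributes +1 to the inner product, and the negative
contributions would require it to be also a smaller index of one of the
triples.  So comparing last indices orders each aligned pair. *)
Lemma aligned_neq_last u v : aligned R u v -> u.2 != v.2.
Proof.
case: u v => [[a b] c] [[d e] f]; rewrite alignedE /= => /and3P[abc def].
apply: contraTneq => cf; rewrite -{}cf in def *.
have [-> -> -> ->] : [/\ (a == c) = false, (b == c) = false,
  (c == d) = false & (c == e) = false] by rewrite -!val_eqE /=; split; lia.
by rewrite addn1.
Qed.

(** The pairs (u, v) in which the last index r of u feeds v, that is, the
products a_u a_v through the middle index r that can contribute to J_ijk^l.
Testing r < k separates the one pair with r first in v from the three pairs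
with r second in v, and keeps the list free of duplicates when r = k; members
outside Theta_n are discarded later. *)
Definition feeding_pairs i j k l r : seq (triple n * triple n) :=
  if (r < k)%N then [:: ((i, j, r), (r, k, l))]
  else [:: ((i, j, r), (k, r, l)); ((i, k, r), (j, r, l));
           ((j, k, r), (i, r, l))].

Lemma feeding_pairs_uniq i j k l r :
  (i < j < k)%N && (k < l)%N -> uniq (feeding_pairs i j k l r).
Proof.
move=> ijkl; rewrite /feeding_pairs; case: ifP => //= _.
by rewrite !inE !xpair_eqE -!val_eqE /=; lia.
Qed.

(** An inner product of -1 leaves room for one coincidence only, between the
last index of u and one of the first two of v.  If it is the first index of v,
the four other indices are already in order; if it is the second, the three
shapes correspond to the position of the first index of v among those of u. *)
Lemma aligned_feeding u v :
  aligned R u v -> (u.2 < v.2)%N ->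
  exists i j k l,
    (i < j < k)%N && (k < l)%N /\ (u, v) \in feeding_pairs i j k l u.2.
Proof.
case: u v => [[a b] c] [[d e] f]; rewrite alignedE /= -!val_eqE /=.
case/and3P=> abc def + cf.
have [af bf cf'] : [/\ (a == f :> nat) = false, (b == f :> nat) = false
    & (c == f :> nat) = false] by split; lia.
have cde : ~~ ((c == d :> nat) && (c == e :> nat)) by lia.
move=> dot; have {dot} [ad bd] : [/\ a != d :> nat, b != d :> nat &
    (c == d :> nat) || (c == e :> nat)].
  move: dot cde; rewrite af bf cf'.
  by case: (a == d :> nat); case: (a == e :> nat); case: (b == d :> nat);
     case: (b == e :> nat); case: (c == d :> nat); case: (c == e :> nat).
case/orP=> /eqP/val_inj ce; [subst d | subst e].
  exists a, b, e, f; split; first by lia.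
  by rewrite /feeding_pairs ifT ?mem_seq1 //; lia.
have [b_d | d_b] := ltnP b d.
  exists a, b, d, f; split; first by lia.
  by rewrite /feeding_pairs ifF ?inE ?eqxx //; lia.
have [a_d | d_a] := ltnP a d.
  exists a, d, b, f; split; first by lia.
  by rewrite /feeding_pairs ifF ?inE ?eqxx ?orbT //; lia.
exists d, a, b, f; split; first by lia.
by rewrite /feeding_pairs ifF ?inE ?eqxx ?orbT //; lia.
Qed.

Lemma feeding_pairs_aligned i j k l r u v :
  (i < j < k)%N && (k < l)%N -> (u, v) \in feeding_pairs i j k l r ->
  u \in Theta n -> v \in Theta n ->
  [/\ u.2 = r, (u.2 < v.2)%N & aligned R u v].
Proof.
move=> ijkl; rewrite /feeding_pairs; case: ltnP => rk; rewrite !inE;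
  [|case/or3P] => /eqP[-> ->] /= uT vT; split=> //; try lia;
  by rewrite alignedE -!val_eqE /=; lia.
Qed.

Lemma quadruple_index_sets u v i j k l :
  (i < j < k)%N && (k < l)%N ->
  (forall s,
    (s \in index_set u) != (s \in index_set v) = (s \in [:: i; j; k; l])) ->
  quadruple u v = [:: i; j; k; l].
Proof.
move=> ijkl uv; apply: enum_ord_sorted => [/=|s]; first by lia.
by rewrite -uv !inE; case: (s \in index_set u); case: (s \in index_set v).
Qed.

Lemma feeding_pairs_quadruple i j k l r u v :
  (i < j < k)%N && (k < l)%N -> (u, v) \in feeding_pairs i j k l r ->
  u \in Theta n -> v \in Theta n ->
  quadruple u v = [:: i; j; k; l] /\ index_set u :&: index_set v = [set r].
Proof.
move=> ijkl; rewrite /feeding_pairs; case: ltnP => rk; rewrite !inE;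
  [|case/or3P] => /eqP[-> ->] /= uT vT; split;
  try (by apply: quadruple_index_sets => // s; rewrite !inE -!val_eqE /=; lia);
  by apply/setP=> s; rewrite !inE -!val_eqE /=; lia.
Qed.

Lemma set2_neq (T : finType) (a b c d : T) :
  ~~ [&& (a == c) || (a == d) & (b == c) || (b == d)] ->
  ([set a; b] == [set c; d]) = false.
Proof.
apply: contraNF => /eqP E.
by have := set21 a b; have := set22 a b; rewrite E !inE => -> ->.
Qed.

(** The order i < j < k < l and the common index r identify i, j, k, l with
the q1, q2, q3, q4 and r of the sign table; when the sign is -1, the three
shapes of sign +1, which are tested first, have to be excluded. *)
Lemma sign_feeding i j k l r :
 (i < j < k)%N && (k < l)%N ->
  [/\ (j < r < k)%N -> sign (i, j, r) (r, k, l) = 1,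
      (k < r < l)%N -> sign (i, j, r) (k, r, l) = -1,
      (k < r < l)%N -> sign (i, k, r) (j, r, l) = 1 &
      (k < r < l)%N -> sign (j, k, r) (i, r, l) = -1].
Proof.
move=> ijkl; split=> r_bounds.
- have [|||q4 cap] := @feeding_pairs_quadruple i j k l r (i, j, r) (r, k, l) ijkl;
    rewrite ?in_Theta; try lia.
    by rewrite /feeding_pairs ifT ?inE //; lia.
  by rewrite /sign q4 cap enum_set1 eqxx.
- have [|||q4 cap] := @feeding_pairs_quadruple i j k l r (i, j, r) (k, r, l) ijkl;
    rewrite ?in_Theta; try lia.
    by rewrite /feeding_pairs ifF ?inE ?eqxx //; lia.
  rewrite /sign q4 cap enum_set1.
  by rewrite 3?set2_neq ?eqxx // !xpair_eqE -!val_eqE /=; lia.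
- have [|||q4 cap] := @feeding_pairs_quadruple i j k l r (i, k, r) (j, r, l) ijkl;
    rewrite ?in_Theta; try lia.
    by rewrite /feeding_pairs ifF ?inE ?eqxx ?orbT //; lia.
  by rewrite /sign q4 cap enum_set1 eqxx orbT.
- have [|||q4 cap] := @feeding_pairs_quadruple i j k l r (j, k, r) (i, r, l) ijkl;
    rewrite ?in_Theta; try lia.
    by rewrite /feeding_pairs ifF ?inE ?eqxx ?orbT //; lia.
  rewrite /sign q4 cap enum_set1.
  by rewrite 3?set2_neq ?eqxx ?orbT // !xpair_eqE -!val_eqE /=; lia.
Qed.

End AlignedPairs.

(** * Coordinates of the Jacobiator as sums over aligned pairs *)

(** Two ways o1, o2 of choosing an order in each unordered pair satisfying C
give the same sum of a symmetric function: the pairs on which o1 and o2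
disagree are matched by exchanging the two entries. *)
Lemma sum_oriented_pairs (V : nmodType) (I : finType) (o1 o2 C : rel I)
    (F : I -> I -> V) :
  symmetric C -> (forall p r, F p r = F r p) ->
  (forall p r, C p r -> o1 r p = ~~ o1 p r) ->
  (forall p r, C p r -> o2 r p = ~~ o2 p r) ->
  \sum_p \sum_(r | o1 p r && C p r) F p r
    = \sum_p \sum_(r | o2 p r && C p r) F p r.
Proof.
move=> C_sym F_sym o1C o2C.
under eq_bigr => p _ do rewrite (bigID (o2 p)) /=.
under [RHS]eq_bigr => p _ do rewrite (bigID (o1 p)) /=.
rewrite !big_split /=; congr (_ + _).
  apply: eq_bigr => p _; apply: eq_bigl => r.
  by rewrite andbAC (andbC (o1 p r)) andbAC.
rewrite (exchange_big_dep predT) //=.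
apply: eq_bigr => r _; apply: eq_big => [p|p _]; last exact: F_sym.
rewrite C_sym; case Crp: (C r p); rewrite ?andbF //= !andbT.
by rewrite (o1C r p Crp) (o2C r p Crp) negbK andbC.
Qed.

Section JacobiCoefficients.
Variables (R : realType) (K : comNzRingType) (n : nat).
Variable a : 'I_n -> 'I_n -> 'I_n -> K.
Hypothesis a_anti : forall i j k, a i j k = - a j i k.
Hypothesis a_alt : forall i k, a i i k = 0.
Hypothesis a_Theta : forall i j k : 'I_n, (i < j)%N -> ~~ (j < k)%N -> a i j k = 0.
Let A (t : triple n) : K := let: (i, j, k) := t in a i j k.

Definition jacobi_coef (i j k l : 'I_n) : K :=
  \sum_r (a i j r * a r k l + a j k r * a r i l + a k i r * a r j l).

Lemma low_coef_eq0 (i j k : 'I_n) : (k <= i)%N || (k <= j)%N -> a i j k = 0.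
Proof.
case: (ltngtP i j) => [ij kij|ji kij|/val_inj-> _]; last exact: a_alt.
  by apply: a_Theta => //; lia.
by rewrite a_anti a_Theta ?oppr0 //; lia.
Qed.

(** A nonzero product raises the index at each factor, so from i, j, k it can
only reach an l above all three of them. *)
Lemma jacobi_coef_eq0 (i j k l : 'I_n) :
  (i < j < k)%N -> (l <= k)%N -> jacobi_coef i j k l = 0.
Proof.
move=> ijk lk; apply: big1 => r _; rewrite (@low_coef_eq0 r k l) ?lk ?orbT //.
have [rk|kr] := leqP r k.
  by rewrite (@low_coef_eq0 j k r) ?(@low_coef_eq0 k i r); [ring|lia..].
by rewrite (@low_coef_eq0 r i l) ?(@low_coef_eq0 r j l); [ring|lia..].
Qed.

(** Both sides are grouped by the middle index r, which on the right is the
last index of the first triple; for each r the two sums run over the same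
at most three products. *)
Lemma jacobi_coef_pairs (i j k l : 'I_n) : (i < j < k)%N && (k < l)%N ->
  jacobi_coef i j k l =
  \sum_(w : triple n * triple n | (w.1.2 < w.2.2)%N &&
     (aligned R w.1 w.2 && (quadruple w.1 w.2 == [:: i; j; k; l])))
     (sign w.1 w.2)%:~R * A w.1 * A w.2.
Proof.
move=> ijkl; rewrite (partition_big (fun w => w.1.2) predT) //=.
apply: eq_bigr => r _.
transitivity (\sum_(w <- feeding_pairs i j k l r)
   if (w.1 \in Theta n) && (w.2 \in Theta n)
   then (sign w.1 w.2)%:~R * A w.1 * A w.2 else 0).
  have [s1 s2 s3 s4] := sign_feeding r ijkl.
  rewrite /feeding_pairs; case: ltnP => rk;
    rewrite !big_cons big_nil !in_Theta /A /=.
    rewrite (a_anti k i r) (a_Theta (_ : (j < k)%N)) ?(a_Theta (_ : (i < k)%N));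
      try lia.
    rewrite oppr0 !mul0r !addr0; case: ifPn => [c|c].
      by rewrite s1 ?mul1r //; lia.
    by rewrite (@a_Theta i j r) ?mul0r //; lia.
  have -> : (i < j < r)%N && (k < r < l)%N = (k < r < l)%N by lia.
  have -> : (i < k < r)%N && (j < r < l)%N = (k < r < l)%N by lia.
  have -> : (j < k < r)%N && (i < r < l)%N = (k < r < l)%N by lia.
  rewrite (a_anti k i) (a_anti r i) (a_anti r j) (a_anti r k).
  case: ifPn => [c|c]; first by rewrite s2 // s3 // s4 //; ring.
  (* Outside k < r < l, each product has a vanishing factor: the first one, or
     a_kk^l, when r = k, and the second one when l <= r. *)
  move: rk; rewrite leq_eqVlt => /orP[/eqP/val_inj <-|kr].
    by rewrite a_alt (@a_Theta j k k) ?(@a_Theta i k k); [ring|lia..].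
  by rewrite (@a_Theta k r l) ?(@a_Theta i r l) ?(@a_Theta j r l); [ring|lia..].
rewrite big_uniq ?feeding_pairs_uniq // -big_mkcondr /=.
apply: eq_bigl => -[u v] /=; apply/andP/andP => [[uv /andP[uT vT]]|].
  have [-> -> ->] := feeding_pairs_aligned R ijkl uv uT vT.
  by have [-> _] := feeding_pairs_quadruple ijkl uv uT vT; rewrite !eqxx.
case=> /and3P[uv al /eqP q4] /eqP ur.
have [uT vT] := aligned_Theta al; rewrite uT vT; split=> //.
have [i' [j' [k' [l' [ijkl' uv']]]]] := aligned_feeding al uv.
have [+ _] := feeding_pairs_quadruple ijkl' uv' uT vT.
by rewrite q4 => -[-> -> -> ->]; rewrite -ur.
Qed.

End JacobiCoefficients.

(** * The Jacobi Identity on a basis *)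

Section JacobiOnBasis.
Variables (K : fieldType) (n : nat) (x : n.-tuple 'rV[K]_n).
Hypothesis x_basis : basis_of fullv x.
Variable alpha : {bilinear 'rV[K]_n -> 'rV[K]_n -> 'rV[K]_n}.
Local Notation a := (struct_const x alpha).

Definition jacobiator u v w :=
  alpha (alpha u v) w + alpha (alpha v w) u + alpha (alpha w u) v.

(** With this, statements about one argument of the Jacobiator transfer to the
other two. *)
Lemma jacobiator_cycle u v w : jacobiator u v w = jacobiator v w u.
Proof. by rewrite /jacobiator -addrA addrC. Qed.

Lemma jacobiator_linear v w : linear (fun u => jacobiator u v w).
Proof.
move=> c u u'; rewrite /jacobiator !(linearPl, linearPr) /= !scalerDr.
by rewrite [RHS]addrACA; congr (_ + _); apply: addrACA.
Qed.

Lemma eq0_on_basis (f : 'rV[K]_n -> 'rV[K]_n) :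
  linear f -> (forall i, f (tnth x i) = 0) -> forall u, f u = 0.
Proof.
move=> f_lin fx u.
pose F : {linear _ -> _} := HB.pack f (GRing.isLinear.Build _ _ _ _ f f_lin).
rewrite -[f u]/(F u) (coord_basis x_basis (memvf u)) linear_sum big1 // => i _.
by rewrite linearZ /= -tnth_nth fx scaler0.
Qed.

Lemma jacobiator_eq0_on_basis :
  (forall i j k, jacobiator (tnth x i) (tnth x j) (tnth x k) = 0) ->
  jacobi_identity alpha.
Proof.
move=> J u v w; apply: (eq0_on_basis (@jacobiator_linear v w)) => i.
rewrite jacobiator_cycle; apply: (eq0_on_basis (@jacobiator_linear _ _)) => j.
by rewrite jacobiator_cycle; apply: (eq0_on_basis (@jacobiator_linear _ _)) => k.
Qed.

Hypothesis alpha_alt : alternating alpha.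

Lemma alternating_anti u v : alpha u v = - alpha v u.
Proof.
apply/eqP; rewrite -addr_eq0; apply/eqP; have := alpha_alt (u + v).
by rewrite linearDl !linearDr /= !alpha_alt add0r addr0 addrC.
Qed.

Lemma struct_const_anti i j k : a i j k = - a j i k.
Proof. by rewrite /struct_const alternating_anti linearN. Qed.

Lemma struct_const_alt i k : a i i k = 0.
Proof. by rewrite /struct_const alpha_alt linear0. Qed.

Lemma jacobiator_alt u w : jacobiator u u w = 0.
Proof.
rewrite /jacobiator alpha_alt linear0l add0r (alternating_anti w u).
by rewrite linearNl addrN.
Qed.

Lemma jacobiator_anti u v w : jacobiator u v w = - jacobiator v u w.
Proof.
rewrite /jacobiator (alternating_anti u v) (alternating_anti v w).
by rewrite (alternating_anti w u) !linearNl !opprD addrAC.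
Qed.

(** A cyclic shift brings the smallest index to the front; then at most one
exchange is left, and a repeated index makes the Jacobiator vanish. *)
Lemma jacobiator_ordered :
  (forall i j k : 'I_n, (i < j < k)%N ->
     jacobiator (tnth x i) (tnth x j) (tnth x k) = 0) ->
  jacobi_identity alpha.
Proof.
move=> J; apply: jacobiator_eq0_on_basis.
pose X i j k := jacobiator (tnth x i) (tnth x j) (tnth x k).
rewrite -/X.
have Xmin (i j k : 'I_n) : (i < j)%N -> (i < k)%N -> X i j k = 0.
  move=> ij ik; case: (ltngtP j k) => [jk|kj|/val_inj <-].
  - by apply: J; rewrite ij.
  - rewrite /X jacobiator_cycle jacobiator_anti -jacobiator_cycle.
    by rewrite J ?oppr0 ?ik.
  - by rewrite /X jacobiator_cycle jacobiator_alt.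
have Xle (i j k : 'I_n) : (i <= j)%N -> (i <= k)%N -> X i j k = 0.
  rewrite leq_eqVlt => /orP[/eqP/val_inj<- _|ij]; first exact: jacobiator_alt.
  rewrite leq_eqVlt => /orP[/eqP/val_inj<-|ik]; last exact: Xmin.
  by rewrite /X -jacobiator_cycle jacobiator_alt.
move=> i j k; have [ij|ji] := leqP i j.
  have [ik|ki] := leqP i k; first exact: Xle.
  by rewrite /X -jacobiator_cycle; apply: Xle; lia.
have [jk|kj] := leqP j k; first by rewrite /X jacobiator_cycle; apply: Xle; lia.
by rewrite /X -jacobiator_cycle; apply: Xle; lia.
Qed.

Lemma coord_alpha (u : 'rV[K]_n) k l :
  coord x l (alpha u (tnth x k)) = \sum_r coord x r u * a r k l.
Proof.
rewrite {1}(coord_basis x_basis (memvf u)) linear_sumlz linear_sum.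
by apply: eq_bigr => r _; rewrite linearZl_LR linearZ /= -tnth_nth.
Qed.

Lemma coord_jacobiator i j k l :
  coord x l (jacobiator (tnth x i) (tnth x j) (tnth x k)) = jacobi_coef a i j k l.
Proof. by rewrite /jacobiator !linearD /= !coord_alpha -!big_split. Qed.

Lemma jacobi_identityP :
  jacobi_identity alpha <->
  (forall i j k l : 'I_n, (i < j < k)%N -> jacobi_coef a i j k l = 0).
Proof.
split=> [J i j k l _ | J].
  by rewrite -coord_jacobiator [jacobiator _ _ _]J linear0.
apply: jacobiator_ordered => i j k ijk.
rewrite (coord_basis x_basis (memvf (jacobiator _ _ _))) big1 // => l _.
by rewrite coord_jacobiator J ?scale0r.
Qed.

End JacobiOnBasis.

(** * The equivalence *)

Theorem theorem2p1 (R : realType) (K : fieldType) (n : nat) (n_gt0 : (0 < n)%N)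
  (x : n.-tuple 'rV[K]_n) (x_basis : basis_of fullv x)
  (Lambda : {set triple n}) (Lambda_Theta : Lambda \subset Theta n)
  (m : nat) (t : 'I_m -> triple n)
  (t_inj : injective t) (t_enum : [set t p | p : 'I_m] = Lambda)
  (alpha : {bilinear 'rV[K]_n -> 'rV[K]_n -> 'rV[K]_n})
  (alpha_S : in_S x Lambda alpha) :
  jacobi_identity alpha <->
  (forall q : 4.-tuple 'I_n, q \in quadruples R Lambda ->
     \sum_(p < m) \sum_(r < m | [&& (p < r)%N, aligned R (t p) (t r)
                                & quadruple (t p) (t r) == q :> seq 'I_n])
       (sign (t p) (t r))%:~R
         * struct_const_at x alpha (t p) * struct_const_at x alpha (t r) = 0).
Proof.
have [alpha_alt a_Lambda] := alpha_S.
have a_supp (u : triple n) :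
    u \in Theta n -> u \notin Lambda -> struct_const_at x alpha u = 0.
  case: u => [[i j] k]; rewrite inE => /andP[ij _] uL; apply/eqP; apply: contraNT uL.
  by apply (a_Lambda i j k); rewrite inE.
have a_low (i j k : 'I_n) : (i < j)%N -> ~~ (j < k)%N -> struct_const x alpha i j k = 0.
  move=> ij jk; apply/eqP; apply: contraNT jk.
  move/(a_Lambda i j k); rewrite inE => /(_ ij)/(subsetP Lambda_Theta).
  by rewrite inE ij.
have a_anti := struct_const_anti x alpha_alt.
have a_alt := struct_const_alt x alpha_alt.
(* The equation of index (i, j, k, l) is J_ijk^l = 0, whether or not
   (i, j, k, l) is a quadruple for Lambda. *)
have equationE (q : 4.-tuple 'I_n) (i j k l : 'I_n) :
    (i < j < k)%N && (k < l)%N -> q = [:: i; j; k; l] :> seq _ ->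
     \sum_(p < m) \sum_(r < m | [&& (p < r)%N, aligned R (t p) (t r)
                                & quadruple (t p) (t r) == q :> seq 'I_n])
       (sign (t p) (t r))%:~R
         * struct_const_at x alpha (t p) * struct_const_at x alpha (t r)
     = jacobi_coef (struct_const x alpha) i j k l.
  move=> ijkl qE; rewrite (jacobi_coef_pairs R) // qE.
  pose C u v := aligned R u v && (quadruple u v == [:: i; j; k; l] :> seq 'I_n).
  pose W u v :=
    (sign u v)%:~R * struct_const_at x alpha u * struct_const_at x alpha v.
  have CC u v : C u v = C v u by rewrite /C alignedC quadrupleC.
  have WC u v : W u v = W v u by rewrite /W signC mulrAC.
  (* Each pair is listed once, in the order of the enumeration t; list it
     instead with the smaller last index first. *)
  rewrite (@sum_oriented_pairs _ _ (fun p r : 'I_m => (p < r)%N)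
     (fun p r => (t p).2 < (t r).2)%N (fun p r => C (t p) (t r))
     (fun p r => W (t p) (t r))) //; first last.
  - by move=> p r /andP[/aligned_neq_last]; rewrite -val_eqE /=; lia.
  - move=> p r /andP[/aligned_neq_last al _].
    have : p != r by apply: contraNneq al => ->.
    by rewrite -val_eqE /=; lia.
  have sumE (G : triple n -> K) :
      \sum_(p < m) G (t p) = \sum_(u in Lambda) G u.
    by rewrite -t_enum big_imset //=; apply: in2W.
  pose G (u v : triple n) := if (u.2 < v.2)%N && C u v then W u v else 0.
  transitivity (\sum_(u in Lambda) \sum_(v in Lambda) G u v).
    by rewrite -sumE; apply: eq_bigr => p _; rewrite big_mkcond -sumE.
  (* The sum may run over all triples, as aligned triples lie in Theta_n, where
     the structure constants outside Lambda vanish. *)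
  rewrite pair_big /= [LHS]big_mkcond [RHS]big_mkcond /=.
  apply: eq_bigr => -[u v] _ /=; rewrite -/(C u v) -/(W u v) /G.
  case: ifP => //; case: ifP => // /andP[_ /andP[/aligned_Theta[uT vT] _]].
  have [uL /=|uL _] := boolP (u \in Lambda); last first.
    by rewrite /W a_supp // mulr0 mul0r.
  by move/negbT=> vL; rewrite /W (a_supp v) // mulr0.
apply: (iff_trans (jacobi_identityP x_basis alpha_alt)); split=> [J q qL|eqs i j k l ijk].
  move: (qL); rewrite inE => /exists_inP[u uL /exists_inP[v vL /andP[_ /eqP uv]]].
  have := enum_ord_ltn_sorted
    (index_set u :\: index_set v :|: index_set v :\: index_set u).
  rewrite -/(quadruple u v) uv.
  case: q {uv qL} => -[|i [|j [|k [|l []]]]] //= q4 /and4P[ij jk kl _].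
  by rewrite (equationE _ i j k l) ?J // ?ij ?jk.
have [lk|kl] := leqP l k; first exact: jacobi_coef_eq0.
have ijkl : (i < j < k)%N && (k < l)%N by rewrite ijk kl.
have [/eqs|qL] := boolP ([tuple i; j; k; l] \in quadruples R Lambda).
  by rewrite (equationE _ i j k l).
(* No aligned pair in Lambda has this quadruple: the sum is empty. *)
rewrite -(equationE [tuple i; j; k; l]) //.
apply: big1 => p _; apply: big1 => r /and3P[_ al /eqP q4].
case/negP: qL; rewrite inE; apply/exists_inP; exists (t p).
  by rewrite -t_enum imset_f.
apply/exists_inP; exists (t r).
  by rewrite -t_enum imset_f.
by rewrite al q4 eqxx.
Qed.
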